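(* Consider an instance of Balanced-Max-$2$-SAT with $n$ variables and $m$ clauses in which each pair of variables appears together in at most one clause, and let $C$ be its cost Hamiltonian. For all $\gamma,\beta\in\mathbb{R}$, the QAOA$_1$ cost expectation is exactly $$\begin{aligned}\langle C\rangle_1=\langle C\rangle_0&+\frac{\sin(4\beta)\sin(\gamma/2)}{8}\sum_{(ij)\in E}\big(\cos^{d_i}(\gamma/2)+\cos^{d_j}(\gamma/2)\big)\\&-\frac{\sin^2(2\beta)}{4}\sum_{(ij)\in E}\cos^{d_i+d_j-2f_{ij}^+-2f_{ij}^-}(\gamma/2)\;g(f_{ij}^+,f_{ij}^-;\gamma),\end{aligned}$$ where $\langle C\rangle_0=\frac34m$ and $$g(f^+,f^-;\gamma)=\sum_{\substack{1\le\ell\le f^++f^-\\ \ell\ \mathrm{odd}}}\cos^{2(f^++f^--\ell)}(\gamma/2)\,\sin^{2\ell}(\gamma/2)\,\sum_{k=0}^{\ell}(-1)^k\binom{f^+}{\ell-k}\binom{f^-}{k}.$$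
   Context: A Max-$2$-SAT instance consists of $m$ clauses, each the disjunction of two literals (variables or negations) on two distinct Boolean variables among $x_1,\dots,x_n$; the cost $c(x)$ is the number of clauses satisfied by $x\in\{0,1\}^n$. It is balanced if each variable appears negated and unnegated in an equal number of clauses. The graph $G=([n],E)$ has an edge $(ij)$ for each clause on variables $x_i,x_j$ (so $|E|=m$). The parity of an edge (clause) is $-1$ if exactly one of its two variables is negated in the clause, and $+1$ otherwise; the parity of a triangle of $G$ is the product of the parities of its three edges. For an edge $(ij)$, $f_{ij}^{\pm}$ is the number of triangles of $G$ of parity $\pm1$ containing $(ij)$. $d_i+1$ is the degree of vertex $i$ in $G$ (for non-isolated $i$). The cost Hamiltonian is $C=\sum_xc(x)|x\rangle\langle x|$ on $n$ qubits, $B=\sum_{j=1}^nX_j$, $|s\rangle=2^{-n/2}\sum_x|x\rangle$, $|\gamma\beta\rangle=e^{-i\beta B}e^{-i\gamma C}|s\rangle$, $\langle C\rangle_1=\langle\gamma\beta|C|\gamma\beta\rangle$, $\langle C\rangle_0=\langle s|C|s\rangle$. Convention: $\binom{a}{b}=0$ if $b>a$. *)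

(* Defs.v *)
From HB Require Import structures.
From mathcomp Require Import all_boot all_order all_algebra.
From mathcomp Require Import complex.
From mathcomp Require Import all_classical all_reals all_analysis.

Set Implicit Arguments.
Unset Strict Implicit.
Unset Printing Implicit Defensive.

Import Order.TTheory GRing.Theory Num.Theory.
Import numFieldNormedType.Exports.

Local Open Scope ring_scope.
Local Open Scope complex_scope.
Local Open Scope sesquilinear_scope.

Definition bits (n : nat) : finType := {ffun 'I_n -> bool}.

(* [(i, b)] is the variable x_i if [b = false], and its negation if
   [b = true]. *)
Definition literal (n : nat) : Type := ('I_n * bool)%type.

Definition lit_true (n : nat) (x : bits n) (l : literal n) : bool :=
  x l.1 (+) l.2.

Record clause (n : nat) := Clause {
  lit1 : literal n;
  lit2 : literal n;
  lit_distinct : lit1.1 != lit2.1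
}.

Definition instance (n m : nat) : Type := 'I_m -> clause n.

Section Instance.
Variables (n m : nat) (I : instance n m).
Implicit Types (i j k : 'I_n) (e : 'I_m) (T : {set 'I_m}).

Definition cost (x : bits n) : nat :=
  #|[set e | lit_true x (lit1 (I e)) || lit_true x (lit2 (I e))]|.

Definition occurs (l : literal n) e : bool :=
  (l == lit1 (I e)) || (l == lit2 (I e)).

Definition balanced : Prop :=
  forall i, #|[set e | occurs (i, true) e]| = #|[set e | occurs (i, false) e]|.

(* The graph G has one edge per clause, so its edges are the clause indices
   [e : 'I_m]. *)
Definition end1 e : 'I_n := (lit1 (I e)).1.
Definition end2 e : 'I_n := (lit2 (I e)).1.
Definition ends e : {set 'I_n} := [set end1 e; end2 e].

Definition pair_at_most_once : Prop :=
  forall i j, i != j -> (#|[set e | ends e == [set i; j]]| <= 1)%N.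

(* [dg i + 1] is the degree of [i]; isolated vertices get the junk value 0. *)
Definition dg i : nat := #|[set e | i \in ends e]|.-1.

Definition parity e : int :=
  if (lit1 (I e)).2 (+) (lit2 (I e)).2 then -1 else 1.

(* A triangle is a set of three edges joining pairwise three distinct
   vertices. *)
Definition triangle T : bool :=
  (#|T| == 3) &&
  [exists i, exists j, exists k,
    uniq [:: i; j; k] &&
    ([set ends e | e in T] == [set [set i; j]; [set j; k]; [set i; k]])].

Definition triangle_parity T : int := \prod_(e in T) parity e.

Definition num_triangles (s : int) e : nat :=
  #|[set T | [&& triangle T, e \in T & triangle_parity T == s]]|.

Definition fplus e : nat := num_triangles 1 e.
Definition fminus e : nat := num_triangles (-1) e.

End Instance.

(* The limit is taken in the library's norm topology on matrices: entrywise
   convergence, for the norm of K. *)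
Definition expmx (K : numFieldType) (d : nat) (A : 'M[K]_d) : 'M[K]_d :=
  limn (series (fun k : nat => (k`!%:R : K)^-1 *: A ^+ k)).

Section Quantum.
Variable R : realType.
Local Notation C := R[i].

Section Qubits.
Variable n : nat.

(* States of n qubits are column vectors indexed by {0,1}^n, through the
   enumeration of this finite type. *)
Definition hdim : nat := #|bits n|.

Definition ket (x : bits n) : 'cV[C]_hdim := delta_mx (enum_rank x) 0.

Definition adjoint (p q : nat) (A : 'M[C]_(p, q)) : 'M[C]_(q, p) := A ^t*.

Definition flip (j : 'I_n) (x : bits n) : bits n :=
  [ffun k => if k == j then ~~ x k else x k].

Definition pauliX (j : 'I_n) : 'M[C]_hdim :=
  \sum_(x : bits n) ket (flip j x) *m adjoint (ket x).

Definition mixerH : 'M[C]_hdim := \sum_(j < n) pauliX j.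

Definition uniform_state : 'cV[C]_hdim :=
  (2 `^ (- (n%:R / 2)) : R)%:C *: \sum_(x : bits n) ket x.

Definition expectation (A : 'M[C]_hdim) (psi : 'cV[C]_hdim) : C :=
  (adjoint psi *m A *m psi) 0 0.

End Qubits.

Section QAOA.
Variables (n m : nat) (I : instance n m).

Definition costH : 'M[C]_(hdim n) :=
  \sum_(x : bits n) (cost I x)%:R *: (ket x *m adjoint (ket x)).

Definition qaoa1_state (gamma beta : R) : 'cV[C]_(hdim n) :=
  expmx (- ('i%C * beta%:C) *: mixerH n) *m
  (expmx (- ('i%C * gamma%:C) *: costH) *m uniform_state n).

Definition expect0 : C := expectation costH (uniform_state n).

Definition expect1 (gamma beta : R) : C :=
  expectation costH (qaoa1_state gamma beta).

End QAOA.

Definition gfun (fp fm : nat) (gamma : R) : R :=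
  \sum_(1 <= l < (fp + fm).+1 | odd l)
    cos (gamma / 2) ^+ (2 * (fp + fm - l)) * sin (gamma / 2) ^+ (2 * l) *
    \sum_(0 <= k < l.+1) (-1) ^+ k * ('C(fp, l - k) * 'C(fm, k))%:R.

End Quantum.

(* Main.v *)
(** Writing z_k = (-1)^{x_k}, balancedness cancels the linear terms of the cost,
    which becomes the Ising energy 3m/4 - 1/4 sum_e parity(e) z_i z_j.  Both
    exponentials are computed from spectral decompositions: the cost is diagonal
    in the computational basis, and the mixer in the Walsh basis, so that
    e^{-i beta B} is a product of one-qubit kernels.  In the Heisenberg picture
    this turns <Z_u Z_v> into the averages of z_u z_v times the phases obtained
    by flipping u, v, or both.  With the spins u and v fixed these averages
    factor over the other vertices, into the closed form [qaoa_ZZ] valid for an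
    arbitrary Ising cost.  When every pair occurs at most once the couplings are
    0, 1 or -1, and the product over w of cos(gamma/2 (J_uw +- J_vw)) contributes
    a factor cos^2 - sin^2 = cos(gamma) exactly when uvw is a triangle of the
    appropriate parity.  The function g is the odd part of the generating
    function (a + b t)^{f+} (a - b t)^{f-}, a = cos^2, b = sin^2, at t = 1. *)

Require Import Defs.
From HB Require Import structures.
From mathcomp Require Import all_boot all_order all_algebra.
From mathcomp Require Import complex.
From mathcomp Require Import all_classical all_reals all_analysis.
From mathcomp Require Import ring zify.

Set Implicit Arguments.
Unset Strict Implicit.
Unset Printing Implicit Defensive.

Import Order.TTheory GRing.Theory Num.Theory.
Import numFieldNormedType.Exports.

Local Open Scope ring_scope.
Local Open Scope complex_scope.

(** * Matrix exponentials *)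

Section Exponential.
Local Open Scope classical_set_scope.

(** Orthogonality kills the cross terms in each product; the resolution of the identity is what the
    exponent 0 needs. *)
Lemma spectral_expr (K : comPzRingType) d (I : finType) (P : I -> 'M[K]_d)
    (lam : I -> K) k :
  (forall s t, P s *m P t = if s == t then P s else 0) ->
  \sum_s P s = 1%:M ->
  (\sum_s lam s *: P s) ^+ k = \sum_s (lam s ^+ k) *: P s.
Proof.
move=> PP P1; elim: k => [|k IHk].
  by rewrite expr0 -[LHS]P1; apply: eq_bigr => s _; rewrite expr0 scale1r.
rewrite exprS IHk -[LHS]/(_ *m _) mulmx_suml; apply: eq_bigr => s _.
rewrite mulmx_sumr (bigD1 s)//= big1 ?addr0; last first.
  by move=> t ts; rewrite -scalemxAl -scalemxAr PP eq_sym (negbTE ts) !scaler0.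
by rewrite -scalemxAl -scalemxAr PP eqxx scalerA exprS.
Qed.

Lemma cvg_sum_fin (K : numFieldType) (V : normedModType K) (I : finType)
    (u : I -> nat -> V) (l : I -> V) :
  (forall i, u i @ \oo --> l i) -> (fun N => \sum_i u i N) @ \oo --> \sum_i l i.
Proof.
move=> ul; elim: (index_enum I) => [|i r IHr].
  under eq_fun do rewrite big_nil.
  by rewrite big_nil; exact: cvg_cst.
under eq_fun do rewrite big_cons.
by rewrite big_cons; exact: cvgD.
Qed.

(** Each partial sum of the exponential series splits along the projections, so matrix convergence
    reduces to finitely many scalar series. *)
Lemma expmx_spectral (K : numFieldType) d (I : finType) (P : I -> 'M[K]_d)
    (lam w : I -> K) :
  (forall s t, P s *m P t = if s == t then P s else 0) ->
  \sum_s P s = 1%:M ->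
  (forall s, series (fun k => (k`!%:R)^-1 * lam s ^+ k) @ \oo --> w s) ->
  expmx (\sum_s lam s *: P s) = \sum_s w s *: P s.
Proof.
move=> PP P1 cw; apply/cvg_lim; first exact: norm_hausdorff.
rewrite (_ : series _ = fun N => \sum_s
    series (fun k => (k`!%:R)^-1 * lam s ^+ k) N *: P s); last first.
  apply/funext => N; rewrite /series /=.
  under eq_bigr => k _.
    rewrite (spectral_expr lam k PP P1) scaler_sumr; over.
  rewrite exchange_big; apply: eq_bigr => s _.
  by rewrite scaler_suml; apply: eq_bigr => k _; rewrite scalerA.
by apply: cvg_sum_fin => s; exact: cvgZr_tmp.
Qed.

Variable R : realType.

Lemma cvg_real_complex (u : nat -> R) (l : R) :
  u @ \oo --> l ->
  (fun n => (u n)%:C : (R[i] : numFieldType)) @ \oo -->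
    (l%:C : (R[i] : numFieldType)).
Proof.
(* The radius is a complex number; in the order of [R[i]] its positivity forces a zero imaginary
   part. *)
move=> ul; apply/cvgrPdist_lt => -[e e'] /=; rewrite ltcE /= => /andP[/eqP -> e0].
near=> n.
rewrite -rmorphB normc_def /= expr0n addr0 sqrtr_sqr ltcR.
near: n.
by move/cvgrPdist_lt : ul; apply.
Unshelve. all: by end_near. Qed.

Lemma expi_coeff (theta : R) k : (k`!%:R)^-1 * ('i%C * theta%:C) ^+ k =
  (cos_coeff theta k)%:C + 'i%C * (sin_coeff theta k)%:C.
Proof.
rewrite /cos_coeff /sin_coeff /= exprMn.
(* Powers of i split by the parity of k, matching the vanishing of [cos_coeff] at odd and of
   [sin_coeff] at even indices. *)
have -> : ('i%C : R[i]) ^+ k =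
    (~~ odd k)%:R * (-1) ^+ k./2 + 'i%C * ((odd k)%:R * (-1) ^+ k.-1./2).
  rewrite -{1}(odd_double_half k) exprD -mul2n exprM sqr_i.
  have := odd_double_half k; case: (odd k) => /= <-.
    rewrite add1n expr1 mul0r add0r mul1r [_.-1]/= doubleK.
    by congr (_ * _ ^+ _); exact: uphalf_double.
  by rewrite add0n doubleK mul0r mulr0 addr0 expr0.
rewrite -exprnP !rmorphM !fmorphV !rmorphXn !rmorphN1 !rmorph_nat /=.
ring.
Qed.

Lemma cvg_series_expi (theta : R) :
  series (fun k => (k`!%:R)^-1 * ('i%C * theta%:C) ^+ k) @ \oo -->
    ((cos theta)%:C + 'i%C * (sin theta)%:C : (R[i] : numFieldType)).
Proof.
rewrite (_ : series _ = fun N => (series (cos_coeff theta) N)%:C +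
    'i%C * (series (sin_coeff theta) N)%:C); last first.
  apply/funext => N; rewrite /series /=.
  under eq_bigr do rewrite expi_coeff.
  by rewrite big_split /= -mulr_sumr !rmorph_sum.
have cvgc := cvg_real_complex (@is_cvg_series_cos_coeff R theta).
have cvgs := cvg_real_complex (@is_cvg_series_sin_coeff R theta).
(* Unlocking exposes cosine and sine as the limits of their series. *)
rewrite unlock sin.unlock.
apply: (@cvgD (R[i] : numFieldType) (R[i] : numFieldType)^o _ _ _ _ _ _ _ cvgc).
exact: (@cvgZl_tmp (R[i] : numFieldType) (R[i] : numFieldType)^o _ _ _ _ _ _ cvgs).
Qed.
End Exponential.

(** * The two evolution operators *)

(** Distributivity: this is how every sum over bit strings of a product over qubits is evaluated
    below. *)
Lemma sum_bits_prod (K : comPzSemiRingType) n (F : 'I_n -> bool -> K) :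
  \sum_(x : bits n) \prod_k F k (x k) = \prod_k (F k true + F k false).
Proof. by under [RHS]eq_bigr do rewrite -big_bool; rewrite bigA_distr_bigA. Qed.

Lemma prod_eqE (K : comPzSemiRingType) n (x y : bits n) :
  \prod_k ((x k == y k)%:R : K) = (x == y)%:R.
Proof.
have [->|xy] := eqVneq x y; first by apply: big1 => k _; rewrite eqxx.
have /existsP[k xyk] : [exists k, x k != y k].
  apply: contraNT xy => /existsPn xy; apply/eqP/ffunP => k.
  by move: (xy k); rewrite negbK => /eqP.
by rewrite (bigD1 k)//= (negbTE xyk) mul0r.
Qed.

(** * Matrices as kernels on bit strings *)

Section Operators.
Variables (R : realType) (n : nat).
Local Notation C := R[i].
Local Notation hdim := (hdim n).

Definition colfn (f : bits n -> C) : 'cV[C]_hdim := \col_i f (enum_val i).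

(** Together with [colfn], it hides the enumeration of bit strings: matrix products become sums over
    bit strings. *)
Definition opmx (K : bits n -> bits n -> C) : 'M[C]_hdim :=
  \matrix_(i, j) K (enum_val i) (enum_val j).

Lemma sum_hdim (F : bits n -> C) :
  \sum_(i < hdim) F (enum_val i) = \sum_x F x.
Proof.
rewrite (reindex (@enum_rank (bits n))) /=; last exact: onW_bij (enum_rank_bij _).
by apply: eq_bigr => x _; rewrite enum_rankK.
Qed.

Lemma mul_opmx K L :
  opmx K *m opmx L = opmx (fun x y => \sum_z K x z * L z y).
Proof.
apply/matrixP => i j; rewrite !mxE -sum_hdim.
by apply: eq_bigr => k _; rewrite !mxE.
Qed.

Lemma mul_opmx_colfn K f :
  opmx K *m colfn f = colfn (fun x => \sum_y K x y * f y).
Proof.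
apply/matrixP => i j; rewrite !mxE -sum_hdim.
by apply: eq_bigr => k _; rewrite !mxE.
Qed.

Lemma opmx1 : opmx (fun x y => (x == y)%:R) = 1%:M.
Proof. by apply/matrixP => i j; rewrite !mxE (inj_eq enum_val_inj). Qed.

Lemma sum_scale_opmx (I : finType) (a : I -> C) (K : I -> bits n -> bits n -> C) :
  \sum_s a s *: opmx (K s) = opmx (fun x y => \sum_s a s * K s x y).
Proof.
by apply/matrixP => i j; rewrite summxE mxE; apply: eq_bigr => s _; rewrite !mxE.
Qed.

Lemma sum_opmx (I : finType) (K : I -> bits n -> bits n -> C) :
  \sum_s opmx (K s) = opmx (fun x y => \sum_s K s x y).
Proof.
by apply/matrixP => i j; rewrite summxE mxE; apply: eq_bigr => s _; rewrite !mxE.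
Qed.

Lemma ket_adjoint x y : ket R x *m adjoint (ket R y) =
  opmx (fun x' y' => ((x' == x) && (y' == y))%:R).
Proof.
rewrite /ket /adjoint trmx_delta map_delta_mx mul_delta_mx.
apply/matrixP => i j; rewrite !mxE.
by rewrite !(can2_eq enum_valK enum_rankK).
Qed.

Lemma uniform_stateE :
  uniform_state R n = colfn (fun=> (2 `^ (- (n%:R / 2)))%:C).
Proof.
apply/matrixP => i j; rewrite !mxE summxE (bigD1 (enum_val i))//= !mxE enum_valK.
rewrite eqxx ord1 eqxx big1 ?addr0 ?mulr1// => x xi.
rewrite !mxE andbT; case: eqP => // ix.
by move: xi; rewrite ix enum_rankK eqxx.
Qed.

Lemma expectation_diag (c : bits n -> C) f :
  Defs.expectation (\sum_x c x *: (ket R x *m adjoint (ket R x))) (colfn f) =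
  \sum_x c x * (f x * (f x)^*).
Proof.
under eq_bigr do rewrite ket_adjoint.
rewrite sum_scale_opmx /Defs.expectation -mulmxA mul_opmx_colfn mxE -sum_hdim.
apply: eq_bigr => i _; rewrite !mxE (bigD1 (enum_val i))//= [X in _ + X]big1 ?addr0.
  rewrite (bigD1 (enum_val i))//= [X in _ + X]big1 ?addr0 => [|x xi].
    by rewrite eqxx mulr1 mulrC mulrA.
  by rewrite [enum_val i == x]eq_sym (negbTE xi) andbF mulr0.
move=> x xi; rewrite big1 ?mul0r// => y _.
by case: andP => [[/eqP <- /eqP xx]|]; rewrite ?mulr0//; move: xi; rewrite xx eqxx.
Qed.

Definition expi (t : R) : C := cos t +i* sin t.

Lemma expiD s t : expi (s + t) = expi s * expi t.
Proof. by rewrite /expi cosD sinD; simpc; rewrite [X in _ +i* X]addrC. Qed.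

Lemma expi0 : expi 0 = 1.
Proof. by rewrite /expi cos0 sin0. Qed.

Lemma expiN t : expi (- t) = ((expi t)^*)%R.
Proof. by rewrite /expi cosN sinN. Qed.

Lemma expi_sum (I : Type) (r : seq I) (P : pred I) (t : I -> R) :
  expi (\sum_(i <- r | P i) t i) = \prod_(i <- r | P i) expi (t i).
Proof. exact: (big_morph expi expiD expi0). Qed.

Lemma expmx_spectral_expi (I : finType) (P : I -> 'M[C]_hdim) (t : I -> R) :
  (forall s s', P s *m P s' = if s == s' then P s else 0) ->
  \sum_s P s = 1%:M ->
  expmx (\sum_s ('i%C * (t s)%:C) *: P s) = \sum_s expi (t s) *: P s.
Proof.
move=> PP P1; rewrite (expmx_spectral PP P1 (fun s => @cvg_series_expi R (t s))).
by apply: eq_bigr => s _; congr (_ *: _); rewrite /expi; simpc.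
Qed.

End Operators.

(** * Closed forms of the cost and mixer evolutions *)

Section Evolution.
Variables (R : realType) (n : nat).
Local Notation C := R[i].
Local Notation hdim := (hdim n).

(** The rank-one projections on the basis states diagonalize the cost, so each amplitude only
    acquires a phase. *)
Lemma expmx_cost (m : nat) (I : instance n m) (gamma : R) :
  expmx (- ('i%C * gamma%:C) *: costH R I) *m uniform_state R n =
  colfn (fun x => (2 `^ (- (n%:R / 2)))%:C * expi (- gamma * (cost I x)%:R)).
Proof.
have -> : - ('i%C * gamma%:C) *: costH R I =
    \sum_x ('i%C * (- gamma * (cost I x)%:R)%:C) *:
             opmx (fun x' y' => ((x' == x) && (y' == x))%:R : C).
  rewrite /costH scaler_sumr; apply: eq_bigr => x _.
  by rewrite scalerA ket_adjoint rmorphM rmorphN rmorph_nat mulNr mulNr mulrN mulrA.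
rewrite expmx_spectral_expi; last 2 first.
- move=> x y; rewrite mul_opmx.
  case: eqP => [<-|xy]; apply/matrixP => i j; rewrite !mxE.
    rewrite (bigD1 x)//= big1 ?addr0 => [|z zx].
      by rewrite eqxx andbT -natrM mulnb.
    by rewrite (negbTE zx) andbF mul0r.
  rewrite big1// => z _; rewrite -natrM mulnb.
  by case: (eqVneq z x) => [->|_]; rewrite ?andbF // (introF eqP xy) ?andbF.
- rewrite sum_opmx -opmx1; apply/matrixP => i j; rewrite !mxE.
  rewrite (bigD1 (enum_val i))//= eqxx big1 ?addr0 1?eq_sym// => x xi.
  by rewrite [_ == x]eq_sym (negbTE xi).
rewrite uniform_stateE sum_scale_opmx mul_opmx_colfn.
apply/matrixP => i j; rewrite !mxE (bigD1 (enum_val i))//= [X in _ + X]big1 => [|x xi].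
  rewrite addr0 mulrC; congr (_ * _).
  rewrite (bigD1 (enum_val i))//= [X in _ + X]big1 => [|x xi].
    by rewrite addr0 eqxx mulr1.
  by rewrite [_ == x]eq_sym (negbTE xi) mulr0.
rewrite [X in X * _]big1 ?mul0r// => y _.
by case: eqP => [<-|_] /=; rewrite ?(negbTE xi) ?mulr0.
Qed.

(** These are the characters of the group (Z/2)^n, which are common eigenvectors of all the
    [pauliX j]. *)
Definition walsh (s x : bits n) : C := \prod_k (-1) ^+ (s k && x k).

(** The sum factors over the bits. Through [walshC] it also serves as the completeness relation of
    the characters. *)
Lemma walsh_ortho (s t : bits n) :
  2 ^- n * \sum_x walsh s x * walsh t x = (s == t)%:R.
Proof.
rewrite -prod_eqE /walsh.
under [X in _ * X]eq_bigr do rewrite -big_split /=.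
rewrite (sum_bits_prod (fun k b => (-1) ^+ (s k && b) * (-1) ^+ (t k && b))).
have -> : 2 ^- n = \prod_(k < n) (2^-1 : C) by rewrite prodr_const card_ord exprVn.
rewrite -big_split /=; apply: eq_bigr => k _.
by case: (s k) (t k) => -[] /=; field.
Qed.

Lemma walshC (s x : bits n) : walsh s x = walsh x s.
Proof. by apply: eq_bigr => k _; rewrite andbC. Qed.

(** This is the eigenvalue equation of the Pauli X at [j], with eigenvalue given by the bit
    [s j]. *)
Lemma walsh_flip (s x : bits n) j :
  walsh s (flip j x) = (-1) ^+ s j * walsh s x.
Proof.
rewrite /walsh (bigD1 j)//= [in RHS](bigD1 j)//= mulrA ffunE eqxx; congr (_ * _).
  by case: (s j) (x j) => -[] /=; ring.
by apply: eq_bigr => k /negbTE kj; rewrite ffunE kj.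
Qed.

Definition mixer_proj (s : bits n) : 'M[C]_hdim :=
  opmx (fun x y => 2 ^- n * (walsh s x * walsh s y)).

Definition mixer_eig (s : bits n) : R := \sum_j (-1) ^+ s j.

Lemma mixer_projM s t :
  mixer_proj s *m mixer_proj t = if s == t then mixer_proj s else 0.
Proof.
rewrite mul_opmx; apply/matrixP => i j; rewrite !mxE.
transitivity (2 ^- n * (walsh s (enum_val i) * walsh t (enum_val j)) *
    (2 ^- n * \sum_z walsh s z * walsh t z)).
  by rewrite !mulr_sumr; apply: eq_bigr => z _; ring.
by rewrite walsh_ortho; case: eqP => [<-|_]; rewrite ?mulr1 ?mulr0 mxE.
Qed.

Lemma mixer_proj_sum : \sum_s mixer_proj s = 1%:M.
Proof.
rewrite sum_opmx -opmx1; apply/matrixP => i j; rewrite !mxE -walsh_ortho mulr_sumr.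
by apply: eq_bigr => s _; rewrite !(walshC s).
Qed.

Lemma mixerHE : mixerH R n = \sum_s (mixer_eig s)%:C *: mixer_proj s.
Proof.
rewrite sum_scale_opmx /mixerH.
have pX j : pauliX R j = opmx (fun x y => (x == flip j y)%:R).
  rewrite /pauliX; under eq_bigr do rewrite ket_adjoint.
  rewrite sum_opmx; apply/matrixP => i k; rewrite !mxE (bigD1 (enum_val k))//= eqxx andbT.
  by rewrite big1 ?addr0// => x xk; rewrite [_ == x]eq_sym (negbTE xk) andbF.
under eq_bigr do rewrite pX.
rewrite sum_opmx; apply/matrixP => i k; rewrite !mxE.
(* Each delta kernel of a Pauli X is expanded in characters; the flip then yields the eigenvalue. *)
under eq_bigr do rewrite -walsh_ortho mulr_sumr.
rewrite exchange_big; apply: eq_bigr => s _ /=.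
rewrite rmorph_sum mulr_suml; apply: eq_bigr => j _.
rewrite rmorph_sign !(walshC _ s) walsh_flip; ring.
Qed.

(** Entries of the one-qubit operator e^{-i beta X} = cos(beta) - i sin(beta) X. *)
Definition qubit_kernel (beta : R) (a b : bool) : C :=
  if a == b then (cos beta)%:C else - ('i%C * (sin beta)%:C).

Lemma expmx_mixer (beta : R) :
  expmx (- ('i%C * beta%:C) *: mixerH R n) =
  opmx (fun x y => \prod_k qubit_kernel beta (x k) (y k)).
Proof.
have -> : - ('i%C * beta%:C) *: mixerH R n =
    \sum_s ('i%C * (- beta * mixer_eig s)%:C) *: mixer_proj s.
  rewrite mixerHE scaler_sumr; apply: eq_bigr => s _.
  by rewrite scalerA rmorphM rmorphN !mulNr mulrN mulrA.
rewrite (expmx_spectral_expi _ mixer_projM mixer_proj_sum) sum_scale_opmx.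
apply/matrixP => i j; rewrite !mxE.
set x := enum_val i; set y := enum_val j.
under [LHS]eq_bigr => s _.
  rewrite mulrCA /walsh -big_split /mixer_eig mulr_sumr expi_sum -big_split /=.
  over.
(* Eigenvalue phases and characters are both products over the bits of s, so the sum over s factors
   into two-term sums, one per qubit. *)
rewrite -mulr_sumr (sum_bits_prod (fun k b => expi (- beta * (-1) ^+ b) *
  ((-1) ^+ (b && x k) * (-1) ^+ (b && y k)))).
have -> : 2 ^- n = \prod_(k < n) (2^-1 : C) by rewrite prodr_const card_ord exprVn.
rewrite -big_split /=; apply: eq_bigr => k _.
have expiE t : expi t = (cos t)%:C + 'i%C * (sin t)%:C :> C.
  by rewrite /expi; simpc.
rewrite expr1 expr0 mulrN1 mulr1 opprK /qubit_kernel !expiE cosN sinN rmorphN.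
by case: (x k) (y k) => -[] /=; field.
Qed.
End Evolution.

(** * Spin correlations *)

Section Heisenberg.
Variables (R : realType) (n : nat) (beta : R).
Local Notation C := R[i].
Implicit Types (x y : bits n) (phi : bits n -> C).

(** The amplitudes of e^{-i beta B} applied to [phi], by [expmx_mixer]. *)
Definition mix phi x : C := \sum_(y : bits n) (\prod_k qubit_kernel beta (x k) (y k)) * phi y.

(** Passage to the Heisenberg picture: once the sum over x is innermost it factors, and each qubit
    carries its own conjugated observable. *)
Lemma mix_expectation (a : 'I_n -> bool -> C) phi :
  \sum_(x : bits n) (\prod_k a k (x k)) * (mix phi x * (mix phi x)^*) =
  \sum_(y : bits n) \sum_(y' : bits n) phi y * (phi y')^* *
    \prod_k (\sum_b a k b * (qubit_kernel beta b (y k) * (qubit_kernel beta b (y' k))^*)).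
Proof.
under [RHS]eq_bigr => y _ do under eq_bigr => y' _ do
  rewrite bigA_distr_bigA mulr_sumr.
under [RHS]eq_bigr do rewrite exchange_big.
rewrite exchange_big; apply: eq_bigr => x _.
rewrite [X in _ * (X * _)]/mix mulr_suml mulr_sumr; apply: eq_bigr => y _.
rewrite /mix rmorph_sum !mulr_sumr; apply: eq_bigr => y' _.
rewrite rmorphM rmorph_prod !big_split /=; ring.
Qed.

Lemma qubit_kernelJ b b' :
  ((qubit_kernel beta b b')^*)%R =
  if b == b' then (cos beta)%:C else 'i%C * (sin beta)%:C.
Proof. by rewrite -[LHS]/(conjc _) /qubit_kernel; case: eqP => _; simpc. Qed.

Lemma qubit_unitary b b' :
  \sum_c qubit_kernel beta c b * (qubit_kernel beta c b')^* = (b == b')%:R.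
Proof.
rewrite big_bool !qubit_kernelJ /qubit_kernel.
have ii : 'i%C ^+ 2 = -1 :> C := sqr_i _.
have cs : (sin beta)%:C ^+ 2 = 1 - (cos beta)%:C ^+ 2 :> C.
  by rewrite -!rmorphXn /= sin2cos2 rmorphB rmorph1.
by case: b b' => -[] /=; ring: ii cs.
Qed.

(** Conjugating Z by the one-qubit mixer gives cos(2 beta) Z + sin(2 beta) Y; the term with
    [b != b'] is the entry of Y. *)
Lemma qubit_pauliZ b b' :
  \sum_c (-1) ^+ (c : bool) * (qubit_kernel beta c b * (qubit_kernel beta c b')^*) =
  (-1) ^+ b * ((cos (2 * beta))%:C * (b == b')%:R
               + 'i%C * (sin (2 * beta))%:C * (b != b')%:R).
Proof.
have -> : 2 * beta = beta + beta by ring.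
have ii : 'i%C ^+ 2 = -1 :> C := sqr_i _.
rewrite big_bool !qubit_kernelJ /qubit_kernel cosD sinD.
rewrite rmorphB !rmorphD !rmorphM /=.
by case: b b' => -[] /=; ring: ii.
Qed.

Lemma mix_norm phi :
  \sum_(x : bits n) mix phi x * (mix phi x)^* = \sum_x phi x * (phi x)^*.
Proof.
transitivity (\sum_(x : bits n) (\prod_(k < n) 1) * (mix phi x * (mix phi x)^*)).
  by apply: eq_bigr => x _; rewrite big1// mul1r.
rewrite (mix_expectation (fun _ _ => 1)); apply: eq_bigr => y _.
rewrite (bigD1 y)//= [X in _ + X]big1 ?addr0.
  rewrite big1 ?mulr1// => k _; under eq_bigr do rewrite mul1r.
  by rewrite qubit_unitary eqxx.
move=> y' yy'; under eq_bigr => k _.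
  under eq_bigr do rewrite mul1r.
  rewrite qubit_unitary; over.
by rewrite prod_eqE eq_sym (negbTE yy') mulr0.
Qed.

Lemma prod_pair (K : comPzSemiRingType) (I : finType) (u v : I) (F : I -> K) :
  u != v -> \prod_k F k = F u * (F v * \prod_(k | (k != u) && (k != v)) F k).
Proof. by move=> uv; rewrite (bigD1 u)//= (bigD1 v) 1?eq_sym. Qed.

(** Two rotated copies of cos Z + sin Y expand into ZZ, YZ, ZY and YY. The other qubits contribute
    the identity, so only strings differing from y inside {u, v} remain; the minus sign of YY is
    i^2. *)
Lemma mix_pauliZZ phi u v : u != v ->
  \sum_(x : bits n) (-1) ^+ x u * (-1) ^+ x v * (mix phi x * (mix phi x)^*) =
  \sum_(y : bits n) (-1) ^+ y u * (-1) ^+ y v * (phi y *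
    ((cos (2 * beta))%:C ^+ 2 * (phi y)^*
     + 'i%C * (cos (2 * beta) * sin (2 * beta))%:C *
         ((phi (flip u y))^* + (phi (flip v y))^*)
     - (sin (2 * beta))%:C ^+ 2 * (phi (flip u (flip v y)))^*)).
Proof.
move=> uv.
have vu : (v == u) = false by rewrite eq_sym (negbTE uv).
have {vu} [uv' vu] : (u == v) = false /\ (v == u) = false by rewrite (negbTE uv).
(* One-qubit factors of the observable: Z at u and v, the identity elsewhere. *)
pose a k b : C := if (k == u) || (k == v) then (-1) ^+ (b : bool) else 1.
transitivity (\sum_(x : bits n) (\prod_k a k (x k)) * (mix phi x * (mix phi x)^*)).
  apply: eq_bigr => x _; congr (_ * _).
  rewrite (prod_pair _ uv) /a !eqxx orbT /= big1 ?mulr1//.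
  by move=> k /andP[/negbTE -> /negbTE ->].
rewrite mix_expectation; apply: eq_bigr => y _.
have E y' : \prod_k (\sum_b a k b * (qubit_kernel beta b (y k) * (qubit_kernel beta b (y' k))^*)) =
    (-1) ^+ y u * (-1) ^+ y v *
    ((cos (2 * beta))%:C ^+ 2 * (y == y')%:R
     + 'i%C * (cos (2 * beta) * sin (2 * beta))%:C *
         ((flip u y == y')%:R + (flip v y == y')%:R)
     - (sin (2 * beta))%:C ^+ 2 * (flip u (flip v y) == y')%:R).
  rewrite (prod_pair _ uv) {1 2}/a !eqxx orbT !qubit_pauliZ.
  rewrite -!prod_eqE.
  rewrite [X in _ = _ * (_ * X + _ * (_ + _) - _)](prod_pair _ uv).
  rewrite [X in _ = _ * (_ + _ * (X + _) - _)](prod_pair _ uv).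
  rewrite [X in _ = _ * (_ + _ * (_ + X) - _)](prod_pair _ uv).
  rewrite [X in _ = _ * (_ - _ * X)](prod_pair _ uv) !ffunE !eqxx uv' vu.
  set Q := \prod_(k | _) ((y k == y' k)%:R : C).
  have Qf f : (forall k, k != u -> k != v -> f k = y k) ->
      \prod_(k | (k != u) && (k != v)) ((f k == y' k)%:R : C) = Q.
    by move=> fy; apply: eq_bigr => k /andP[ku kv]; rewrite fy.
  rewrite !Qf; last 3 first.
  - by move=> k /negbTE ku /negbTE kv; rewrite !ffunE ku kv.
  - by move=> k /negbTE ku /negbTE kv; rewrite !ffunE kv.
  - by move=> k /negbTE ku /negbTE kv; rewrite !ffunE ku.
  rewrite [X in _ * (_ * X) = _](_ : _ = Q); last first.
    apply: eq_bigr => k /andP[/negbTE ku /negbTE kv].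
    by rewrite /a ku kv; under eq_bigr do rewrite mul1r; rewrite qubit_unitary.
  have ii : 'i%C ^+ 2 = -1 :> C := sqr_i _.
  rewrite rmorphM.
  by case: (y u) (y v) (y' u) (y' v) => -[] [] [] /=; ring: ii.
under eq_bigr do rewrite E.
(* Point values are rewritten as sums against deltas, so that both sides can be compared term by
   term in y'. *)
have pick w (f : bits n -> C) : \sum_(y' : bits n) f y' * (w == y')%:R = f w.
  rewrite (bigD1 w)//= eqxx mulr1 big1 ?addr0// => y' wy.
  by rewrite eq_sym (negbTE wy) mulr0.
rewrite -(pick y (fun y => (phi y)^*)%R) -(pick (flip u y) (fun y => (phi y)^*)%R).
rewrite -(pick (flip v y) (fun y => (phi y)^*)%R).
rewrite -(pick (flip u (flip v y)) (fun y => (phi y)^*)%R).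
rewrite -big_split /= !mulr_sumr -big_split /= -sumrB !mulr_sumr.
by apply: eq_bigr => y' _; ring.
Qed.

End Heisenberg.

(** * The cost as an Ising energy *)

Section Ising.
Variables (R : realType) (n m : nat) (I : instance n m).

Definition spin (x : bits n) (k : 'I_n) : R := (-1) ^+ x k.

Definition edge_spin (x : bits n) (e : 'I_m) : R :=
  spin x (end1 I e) * spin x (end2 I e).

(** Summing over all clauses on the pair gives the Ising coupling even when pairs repeat. *)
Definition coupling (u w : 'I_n) : R :=
  \sum_(e | ends I e == [set u; w]) (parity I e)%:~R.

Lemma coupling_sym u w : coupling u w = coupling w u.
Proof. by rewrite /coupling finset.setUC. Qed.

(** A clause fails only when both literals do. With literal signs s1, s2 equal to 1 on failure, its
    value is 1 - (1 + s1)(1 + s2)/4, and the two negation signs multiply to the parity. *)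
Lemma clause_cost (x : bits n) e :
  (lit_true x (lit1 (I e)) || lit_true x (lit2 (I e)))%:R =
  3 / 4 - 4^-1 * ((-1) ^+ (lit1 (I e)).2 * spin x (end1 I e)
                  + (-1) ^+ (lit2 (I e)).2 * spin x (end2 I e))
  - 4^-1 * ((parity I e)%:~R * edge_spin x e) :> R.
Proof.
rewrite /lit_true /edge_spin /spin /end1 /end2 /parity.
by case: (x _) (x _) (lit1 _).2 (lit2 _).2 => -[] [] [] /=; field.
Qed.

Lemma lit_sum (f : literal n -> R) e :
  f (lit1 (I e)) + f (lit2 (I e)) = \sum_l (occurs I l e)%:R * f l.
Proof.
have l12 : lit1 (I e) != lit2 (I e).
  by apply: contraNneq (lit_distinct (I e)) => ->.
rewrite (bigD1 (lit1 (I e)))//= (bigD1 (lit2 (I e))) 1?eq_sym//=.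
rewrite /occurs !eqxx orbT !mul1r big1 ?addr0// => l /andP[/negbTE -> /negbTE ->].
by rewrite mul0r.
Qed.

Lemma cost_ising (x : bits n) : balanced I ->
  (cost I x)%:R = 3 / 4 * m%:R - 4^-1 * \sum_e (parity I e)%:~R * edge_spin x e :> R.
Proof.
move=> bal; rewrite /cost -sum1_card natr_sum big_mkcond /=.
transitivity (\sum_e (lit_true x (lit1 (I e)) || lit_true x (lit2 (I e)))%:R : R).
  by apply: eq_bigr => e _; rewrite inE; case: (_ || _).
under [LHS]eq_bigr do rewrite clause_cost.
rewrite !big_split /= !sumrN sumr_const card_ord mulr_natr -!mulr_sumr.
suff -> : \sum_e ((-1) ^+ (lit1 (I e)).2 * spin x (end1 I e)
                  + (-1) ^+ (lit2 (I e)).2 * spin x (end2 I e)) = 0 :> R.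
  by rewrite mulr0 subr0.
(* Linear terms are regrouped by literal: the coefficient of each spin becomes its unnegated minus
   its negated count, zero by balance. *)
under [LHS]eq_bigr do rewrite (lit_sum (fun l => (-1) ^+ l.2 * spin x l.1)).
rewrite exchange_big /= -(pair_bigA _ (fun i b =>
  \sum_e (occurs I (i, b) e)%:R * ((-1) ^+ b * spin x i))) /=.
apply: big1 => i _; rewrite big_bool /= -!mulr_suml.
have occ b : \sum_e (occurs I (i, b) e)%:R = #|[set e | occurs I (i, b) e]|%:R :> R.
  rewrite -sum1_card natr_sum [RHS]big_mkcond; apply: eq_bigr => e _.
  by rewrite inE; case: occurs.
by rewrite !occ bal; ring.
Qed.

Lemma set2_eq (T : finType) (a b u w : T) : a != b ->
  ([set a; b] == [set u; w]) = (a == u) && (b == w) || (a == w) && (b == u).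
Proof.
move=> ab; apply/eqP/orP => [E|[]/andP[/eqP-> /eqP->]//]; last by rewrite finset.setUC.
have := finset.set21 a b; have := finset.set22 a b; rewrite E !inE.
move=> /orP[]/eqP bE /orP[]/eqP aE; move: ab; rewrite aE bE ?eqxx// => _.
  by right.
by left.
Qed.

Lemma end12_neq e : end1 I e != end2 I e.
Proof. exact: lit_distinct. Qed.

Lemma sum_ends e u (f : 'I_n -> R) :
  \sum_w (ends I e == [set u; w])%:R * f w =
  (end1 I e == u)%:R * f (end2 I e) + (end2 I e == u)%:R * f (end1 I e).
Proof.
have ab := end12_neq e.
under [LHS]eq_bigr do rewrite set2_eq//.
rewrite (bigD1 (end1 I e))//= (bigD1 (end2 I e)) 1?eq_sym//= !eqxx /=.
rewrite [X in _ + (_ + X)]big1 => [|w /andP[wa wb]]; last first.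
  by rewrite ![_ == w]eq_sym (negbTE wa) (negbTE wb) andbF mul0r.
by rewrite [end2 I e == end1 I e]eq_sym (negbTE ab) !andbF !andbT orbF /= addr0 addrC.
Qed.

(** Double counting turns a sum over the neighbours of [u] into a sum over clauses, where energy
    differences are checked one clause at a time. *)
Lemma coupling_sum u (f : 'I_n -> R) :
  \sum_w coupling u w * f w =
  \sum_e (parity I e)%:~R * ((end1 I e == u)%:R * f (end2 I e)
                             + (end2 I e == u)%:R * f (end1 I e)).
Proof.
under [RHS]eq_bigr do rewrite -sum_ends mulr_sumr.
rewrite exchange_big; apply: eq_bigr => w _ /=.
rewrite /coupling big_mkcond mulr_suml; apply: eq_bigr => e _.
by case: eqP => _; rewrite ?mul1r ?mul0r ?mulr0.
Qed.

Lemma coupling_xx u : coupling u u = 0.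
Proof.
rewrite /coupling big1// => e; rewrite set2_eq ?end12_neq// orbb => /andP[/eqP au /eqP bu].
by have := end12_neq e; rewrite au bu eqxx.
Qed.

(** Only clauses through u change, each by a sign. The neighbour v is kept apart because averages
    are later taken with the spins at u and v fixed. *)
Lemma ising_flip (x : bits n) u v : u != v ->
  \sum_e (parity I e)%:~R * edge_spin x e
  - \sum_e (parity I e)%:~R * edge_spin (flip u x) e =
  2 * (coupling u v * spin x u * spin x v +
       \sum_(w | (w != u) && (w != v)) coupling u w * spin x u * spin x w).
Proof.
move=> uv.
have -> : coupling u v * spin x u * spin x v +
    \sum_(w | (w != u) && (w != v)) coupling u w * spin x u * spin x w =
    \sum_w coupling u w * (spin x u * spin x w).
  rewrite [RHS](bigD1 u)//= coupling_xx mul0r add0r [RHS](bigD1 v) 1?eq_sym//= mulrA.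
  by congr (_ + _); apply: eq_bigr => w _; rewrite mulrA.
rewrite coupling_sum -sumrB mulr_sumr; apply: eq_bigr => e _.
have := end12_neq e; rewrite /edge_spin /spin; move: (end1 I e) (end2 I e) => a b ab.
rewrite !ffunE; case: (eqVneq a u) => [au|_]; case: (eqVneq b u) => [bu|_].
- by move: ab; rewrite au bu eqxx.
- by rewrite au; case: (x u) (x b) => -[] /=; ring.
- by rewrite bu; case: (x u) (x a) => -[] /=; ring.
- by case: (x a) (x b) => -[] /=; ring.
Qed.

(** Clauses on {u, v} are unchanged since both spins flip; only those joining {u, v} to another
    vertex contribute. *)
Lemma ising_flip2 (x : bits n) u v : u != v ->
  \sum_e (parity I e)%:~R * edge_spin x e
  - \sum_e (parity I e)%:~R * edge_spin (flip u (flip v x)) e =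
  2 * \sum_(w | (w != u) && (w != v))
        (coupling u w * spin x u + coupling v w * spin x v) * spin x w.
Proof.
move=> uv.
(* Vanishing at u and v extends the restricted sum to all vertices, so [coupling_sum] applies. *)
pose f w := if (w != u) && (w != v) then spin x w else 0.
have -> : \sum_(w | (w != u) && (w != v))
        (coupling u w * spin x u + coupling v w * spin x v) * spin x w =
    \sum_w coupling u w * (spin x u * f w) + \sum_w coupling v w * (spin x v * f w).
  rewrite -big_split /= big_mkcond /=; apply: eq_bigr => w _; rewrite /f.
  by case: ifP => _; ring.
rewrite !coupling_sum -sumrB -big_split /= mulr_sumr; apply: eq_bigr => e _.
have := end12_neq e; rewrite /f /edge_spin /spin; move: (end1 I e) (end2 I e) => a b ab.
rewrite !ffunE.
have vu : (v == u) = false by rewrite eq_sym (negbTE uv).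
case: (eqVneq a u) => [au|au]; [|case: (eqVneq a v) => [av|av]].
- have /negbTE bu : b != u by rewrite -au eq_sym.
  by rewrite au bu (negbTE uv); case: (eqVneq b v) => [->|_] /=; rewrite ?vu ?signrN; ring.
- have /negbTE bv : b != v by rewrite -av eq_sym.
  by rewrite av bv; case: (eqVneq b u) => [->|_] /=; rewrite ?vu ?signrN; ring.
by case: (eqVneq b u) => [->|_]; [|case: (eqVneq b v) => [->|_]];
  rewrite ?(negbTE uv) /= ?signrN; ring.
Qed.
End Ising.

(** * Phase averages *)

(** Conditioning on the bits at u and v: the four cases have weight 1/4 each, and the remaining bits
    are independent. *)
Lemma pair_average (K : numFieldType) n (u v : 'I_n) (g : bool -> bool -> K)
    (F : bool -> bool -> 'I_n -> bool -> K) : u != v ->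
  2 ^- n * \sum_(y : bits n)
    g (y u) (y v) * \prod_(k | (k != u) && (k != v)) F (y u) (y v) k (y k) =
  4^-1 * \sum_a \sum_b g a b *
    \prod_(k | (k != u) && (k != v)) (2^-1 * (F a b k true + F a b k false)).
Proof.
move=> uv.
have vu : (v == u) = false by rewrite eq_sym (negbTE uv).
(* Indicators at u and v make the conditioned summand a product over all bits; the factor 4 in [E]
   makes up for the 1/2 spent at each of the two. *)
pose H a b k (t : bool) : K :=
  if k == u then (t == a)%:R else if k == v then (t == b)%:R else F a b k t.
have E a b : \prod_(k | (k != u) && (k != v)) (2^-1 * (F a b k true + F a b k false)) =
    4 * 2 ^- n * \sum_(y : bits n) \prod_k H a b k (y k).
  rewrite sum_bits_prod.
  have -> : 2 ^- n = \prod_(k < n) (2^-1 : K) by rewrite prodr_const card_ord exprVn.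
  rewrite -mulrA -big_split /= (prod_pair _ uv) /H !eqxx vu.
  rewrite [in RHS](eq_bigr (fun k => 2^-1 * (F a b k true + F a b k false))).
    by case: a b => -[] /=; field.
  by move=> k /andP[/negbTE -> /negbTE ->].
under [X in _ = _ * X]eq_bigr => a _ do under eq_bigr => b _ do rewrite E !mulr_sumr.
under [X in _ = _ * X]eq_bigr => a _ do rewrite exchange_big.
rewrite [X in _ = _ * X]exchange_big !mulr_sumr; apply: eq_bigr => y _ /=.
rewrite (bigD1 (y u))//= [X in _ + X]big1 => [|a /negbTE yua]; last first.
  apply: big1 => b _; rewrite (bigD1 u)//= /H eqxx [y u == a]eq_sym yua.
  by rewrite mul0r !mulr0.
rewrite (bigD1 (y v))//= [X in _ + X + _]big1 => [|b /negbTE yvb]; last first.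
  by rewrite (prod_pair _ uv) /H !eqxx vu [y v == b]eq_sym yvb mul0r !mulr0.
rewrite (prod_pair _ uv) /H !eqxx vu !mul1r !addr0.
rewrite [in RHS](eq_bigr (fun k => F (y u) (y v) k (y k))).
  by field.
by move=> k /andP[/negbTE -> /negbTE ->].
Qed.

Section Phases.
Variables (R : realType) (n : nat).
Local Notation C := R[i].
Implicit Types (u v w : 'I_n) (a b t : bool) (J K : 'I_n -> R).

Lemma expi_pm (s : R) : expi s + expi (- s) = (2 * cos s)%:C.
Proof. by rewrite /expi cosN sinN; simpc; congr (_ +i* _); ring. Qed.

Lemma expi_mp (s : R) : expi s - expi (- s) = 'i%C * (2 * sin s)%:C.
Proof. by rewrite /expi cosN sinN; simpc; congr (_ +i* _); ring. Qed.

Lemma mean_expi_sign (s : R) b :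
  2^-1 * (expi (s * (-1) ^+ b * (-1) ^+ true) + expi (s * (-1) ^+ b * (-1) ^+ false))
  = (cos s)%:C.
Proof.
have -> : expi (s * (-1) ^+ b * (-1) ^+ true) + expi (s * (-1) ^+ b * (-1) ^+ false)
   = expi s + expi (- s).
  by case: b; rewrite expr1 expr0 ?expr1 ?mulr1 ?mulrN1 ?opprK // addrC.
by rewrite expi_pm rmorphM rmorph_nat mulKf// pnatr_eq0.
Qed.

Lemma ave_ZZ u v : u != v ->
  2 ^- n * \sum_(y : bits n) (-1) ^+ y u * (-1) ^+ y v = 0 :> C.
Proof.
move=> uv.
transitivity (2 ^- n * \sum_(y : bits n) ((-1) ^+ y u * (-1) ^+ y v : C) *
    \prod_(k | (k != u) && (k != v)) 1).
  by congr (_ * _); apply: eq_bigr => y _; rewrite big1 ?mulr1.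
rewrite (pair_average (fun a b => (-1) ^+ a * (-1) ^+ b) (fun _ _ _ _ => 1) uv).
rewrite !big_bool /= !expr1 !expr0.
by set P := \prod_(k | _) _; ring.
Qed.

(** Cosine is even, so the averages over the other spins do not depend on the spin at u; what
    remains is the mean of t e^{i c t} over t = 1 and t = -1, that is i sin(c). *)
Lemma ave_YZ u v (c : R) J : u != v ->
  2 ^- n * \sum_(y : bits n) (-1) ^+ y u * (-1) ^+ y v *
    expi (c * ((-1) ^+ y u * (-1) ^+ y v) +
      \sum_(w | (w != u) && (w != v)) J w * (-1) ^+ y u * (-1) ^+ y w) =
  'i%C * (sin c * \prod_(w | (w != u) && (w != v)) cos (J w))%:C :> C.
Proof.
move=> uv.
have := pair_average
  (fun a b => (-1) ^+ a * (-1) ^+ b * expi (c * ((-1) ^+ a * (-1) ^+ b)) : C)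
  (fun a b w t => expi (J w * (-1) ^+ a * (-1) ^+ t)) uv.
move=> avg; transitivity (4^-1 * \sum_(a : bool) \sum_(b : bool)
    (-1) ^+ a * (-1) ^+ b * expi (c * ((-1) ^+ a * (-1) ^+ b)) *
    \prod_(k | (k != u) && (k != v)) (2^-1 *
      (expi (J k * (-1) ^+ a * (-1) ^+ true) + expi (J k * (-1) ^+ a * (-1) ^+ false)))).
  rewrite -avg; congr (_ * _); apply: eq_bigr => y _.
  by rewrite expiD expi_sum mulrA.
have E (a : bool) : \prod_(k | (k != u) && (k != v)) (2^-1 *
      (expi (J k * (-1) ^+ a * (-1) ^+ true) + expi (J k * (-1) ^+ a * (-1) ^+ false)))
    = \prod_(k | (k != u) && (k != v)) (cos (J k))%:C.
  by apply: eq_bigr => k _; rewrite mean_expi_sign.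
have ee (a b : bool) : c * ((-1) ^+ a * (-1) ^+ b) = if a == b then c else - c.
  by case: a b => -[] /=; ring.
rewrite !big_bool !E !ee rmorphM rmorph_prod /=.
set P := \prod_(k | _) _.
have := expi_mp c; rewrite rmorphM rmorph_nat => cE.
transitivity (4^-1 * (2 * (expi c - expi (- c))) * P); first by ring.
by rewrite cE; field.
Qed.

(** Equal spins at u and v add the two fields, opposite spins subtract them; the sign in front makes
    the difference of the two products. *)
Lemma ave_YY u v J K : u != v ->
  2 ^- n * \sum_(y : bits n) (-1) ^+ y u * (-1) ^+ y v *
    expi (\sum_(w | (w != u) && (w != v))
             (J w * (-1) ^+ y u + K w * (-1) ^+ y v) * (-1) ^+ y w) =
  (2^-1 * (\prod_(w | (w != u) && (w != v)) cos (J w + K w) -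
           \prod_(w | (w != u) && (w != v)) cos (J w - K w)))%:C :> C.
Proof.
move=> uv.
have := pair_average
  (fun a b => (-1) ^+ a * (-1) ^+ b : C)
  (fun a b w t => expi ((J w * (-1) ^+ a + K w * (-1) ^+ b) * (-1) ^+ t)) uv.
move=> avg; transitivity (4^-1 * \sum_(a : bool) \sum_(b : bool) (-1) ^+ a * (-1) ^+ b *
    \prod_(k | (k != u) && (k != v)) (2^-1 *
      (expi ((J k * (-1) ^+ a + K k * (-1) ^+ b) * (-1) ^+ true) +
       expi ((J k * (-1) ^+ a + K k * (-1) ^+ b) * (-1) ^+ false)))).
  by rewrite -avg; congr (_ * _); apply: eq_bigr => y _; rewrite expi_sum.
have E (a b : bool) : \prod_(k | (k != u) && (k != v)) (2^-1 *
      (expi ((J k * (-1) ^+ a + K k * (-1) ^+ b) * (-1) ^+ true) +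
       expi ((J k * (-1) ^+ a + K k * (-1) ^+ b) * (-1) ^+ false)))
    = \prod_(k | (k != u) && (k != v))
        (cos (if a == b then J k + K k else J k - K k))%:C.
  apply: eq_bigr => k _; rewrite -(mean_expi_sign _ a).
  by congr (_ * (expi _ + expi _)); case: a b => -[] /=; ring.
rewrite !big_bool !E /= rmorphM rmorphB !rmorph_prod fmorphV rmorph_nat /=.
set P := \prod_(k | _) _; set Q := \prod_(k | _) (cos (_ - _))%:C.
by field.
Qed.

End Phases.

(** * Cost expectations for a balanced instance *)

Section Expectation.
Variables (R : realType) (n m : nat) (I : instance n m).
Hypothesis bal : balanced I.
Variables (gamma beta : R).
Local Notation C := R[i].
Local Notation J := (coupling R I).

Definition uniform_amp : C := (2 `^ (- (n%:R / 2)) : R)%:C.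

Lemma uniform_amp2 : uniform_amp ^+ 2 = 2 ^- n.
Proof.
rewrite /uniform_amp -rmorphXn /= -powR_mulrn ?powR_ge0// -powRrM.
rewrite mulNr divfK ?pnatr_eq0// powRN powR_mulrn//.
by rewrite fmorphV rmorphXn rmorph_nat.
Qed.

Lemma card_bits_amp : \sum_(y : bits n) 2 ^- n = 1 :> C.
Proof.
rewrite sumr_const card_ffun card_bool card_ord -[LHS]mulr_natl natrX.
by rewrite mulfV// expf_neq0// pnatr_eq0.
Qed.

Definition phase_state (y : bits n) : C := uniform_amp * expi (- gamma * (cost I y)%:R).

(** The constant 3m/4 cancels between the two phases, leaving gamma times a quarter of the energy
    difference. *)
Lemma phase_state_mulJ y y' :
  phase_state y * ((phase_state y')^*)%R =
  2 ^- n * expi (gamma / 4 *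
    (\sum_e (parity I e)%:~R * edge_spin R I y e -
     \sum_e (parity I e)%:~R * edge_spin R I y' e)).
Proof.
have -> : ((phase_state y')^*)%R = uniform_amp * expi (gamma * (cost I y')%:R).
  rewrite /phase_state rmorphM mulNr expiN; congr (_ * _).
    exact: conjc_real.
  exact: conjCK.
rewrite [phase_state y]/phase_state mulrACA -expr2 uniform_amp2 -expiD.
rewrite !cost_ising//; congr (_ * expi _).
by field.
Qed.

Lemma spinC (y : bits n) u : (spin R y u)%:C = (-1) ^+ y u :> C.
Proof. by rewrite rmorph_sign. Qed.

Lemma ave_flip u v : u != v ->
  \sum_(y : bits n) (-1) ^+ y u * (-1) ^+ y v *
     (phase_state y * ((phase_state (flip u y))^*)%R) =
  'i%C * (sin (gamma / 2 * J u v) *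
    \prod_(w | (w != u) && (w != v)) cos (gamma / 2 * J u w))%:C :> C.
Proof.
move=> uv; rewrite -ave_YZ// mulr_sumr; apply: eq_bigr => y _.
rewrite phase_state_mulJ mulrCA; congr (_ * (_ * expi _)).
rewrite (ising_flip R I y uv) !mulrA.
have -> : gamma / 4 * 2 = gamma / 2 by field.
rewrite mulrDr !mulrA; congr (_ + _).
by rewrite mulr_sumr; apply: eq_bigr => w _; rewrite !mulrA.
Qed.

Lemma ave_flip2 u v : u != v ->
  \sum_(y : bits n) (-1) ^+ y u * (-1) ^+ y v *
     (phase_state y * ((phase_state (flip u (flip v y)))^*)%R) =
  (2^-1 * (\prod_(w | (w != u) && (w != v)) cos (gamma / 2 * J u w + gamma / 2 * J v w) -
     \prod_(w | (w != u) && (w != v)) cos (gamma / 2 * J u w - gamma / 2 * J v w)))%:C :> C.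
Proof.
move=> uv; rewrite -ave_YY// mulr_sumr; apply: eq_bigr => y _.
rewrite phase_state_mulJ mulrCA; congr (_ * (_ * expi _)).
rewrite (ising_flip2 R I y uv) !mulrA.
have -> : gamma / 4 * 2 = gamma / 2 by field.
by rewrite mulr_sumr; apply: eq_bigr => w _; rewrite /spin; ring.
Qed.

Lemma qaoa_ZZ u v : u != v ->
  \sum_(x : bits n) (-1) ^+ x u * (-1) ^+ x v *
     (mix beta phase_state x * ((mix beta phase_state x)^*)%R) =
  (- (cos (2 * beta) * sin (2 * beta) * sin (gamma / 2 * J u v) *
      (\prod_(w | (w != u) && (w != v)) cos (gamma / 2 * J u w) +
       \prod_(w | (w != u) && (w != v)) cos (gamma / 2 * J v w))) -
   sin (2 * beta) ^+ 2 *
   (2^-1 *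
    (\prod_(w | (w != u) && (w != v)) cos (gamma / 2 * J u w + gamma / 2 * J v w) -
     \prod_(w | (w != u) && (w != v)) cos (gamma / 2 * J u w - gamma / 2 * J v w))))%:C.
Proof.
move=> uv; rewrite mix_pauliZZ//.
have vu : v != u by rewrite eq_sym.
have E0 : \sum_(y : bits n) (-1) ^+ y u * (-1) ^+ y v *
    (phase_state y * ((phase_state y)^*)%R) = 0.
  rewrite -[RHS](ave_ZZ R uv) mulr_sumr; apply: eq_bigr => y _.
  by rewrite phase_state_mulJ subrr mulr0 expi0 mulr1 mulrC.
(* This is [ave_flip] with u and v exchanged. *)
have Ev : \sum_(y : bits n) (-1) ^+ y u * (-1) ^+ y v *
     (phase_state y * ((phase_state (flip v y))^*)%R) =
  'i%C * (sin (gamma / 2 * J u v) *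
    \prod_(w | (w != u) && (w != v)) cos (gamma / 2 * J v w))%:C.
  transitivity ('i%C * (sin (gamma / 2 * J v u) *
    \prod_(w | (w != v) && (w != u)) cos (gamma / 2 * J v w))%:C).
    by rewrite -(ave_flip vu); apply: eq_bigr => y _; rewrite [X in X * _]mulrC.
  rewrite coupling_sym; congr ('i%C * (_ * _)%:C).
  by apply: eq_bigl => w; rewrite andbC.
transitivity ((cos (2 * beta))%:C ^+ 2 * 0 +
   'i%C * (cos (2 * beta) * sin (2 * beta))%:C *
      ('i%C * (sin (gamma / 2 * J u v) *
          \prod_(w | (w != u) && (w != v)) cos (gamma / 2 * J u w))%:C +
       'i%C * (sin (gamma / 2 * J u v) *
          \prod_(w | (w != u) && (w != v)) cos (gamma / 2 * J v w))%:C)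
   - (sin (2 * beta))%:C ^+ 2 *
  (2^-1 * (\prod_(w | (w != u) && (w != v)) cos (gamma / 2 * J u w + gamma / 2 * J v w) -
     \prod_(w | (w != u) && (w != v)) cos (gamma / 2 * J u w - gamma / 2 * J v w)))%:C).
  rewrite -[X in _ = _ * X + _ - _]E0 -Ev -ave_flip// -ave_flip2//.
  rewrite -big_split /= !mulr_sumr -big_split /= -sumrB.
  by apply: eq_bigr => y _; ring.
have ii : 'i%C ^+ 2 = -1 :> C := sqr_i _.
set P1 := \prod_(w | _) _; set P2 := \prod_(w | _) _; set D := 2^-1 * _.
rewrite !(rmorphB, rmorphN, rmorphM, rmorphD, rmorphXn) /=.
ring: ii.
Qed.

(** Stated for any weights of total 1, so that it serves both the uniform state and the evolved
    one. *)
Lemma sum_cost (f : bits n -> C) : \sum_x f x = 1 ->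
  \sum_x (cost I x)%:R * f x =
  (3 / 4 * m%:R : R)%:C - 4^-1 * \sum_e (parity I e)%:~R *
     \sum_(x : bits n) (-1) ^+ x (end1 I e) * (-1) ^+ x (end2 I e) * f x.
Proof.
move=> f1.
transitivity (\sum_x ((3 / 4 * m%:R : R)%:C * f x - 4^-1 * \sum_e (parity I e)%:~R *
     ((-1) ^+ x (end1 I e) * (-1) ^+ x (end2 I e) * f x))).
  apply: eq_bigr => x _.
  have -> : (cost I x)%:R = ((cost I x)%:R : R)%:C :> C by rewrite rmorph_nat.
  rewrite cost_ising// rmorphB mulrBl; congr (_ - _).
  rewrite rmorphM fmorphV rmorph_nat -mulrA; congr (_ * _).
  rewrite rmorph_sum mulr_suml; apply: eq_bigr => e _.
  by rewrite rmorphM rmorph_int rmorphM /= !spinC !mulrA.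
rewrite sumrB -!mulr_sumr f1 mulr1; congr (_ - _ * _).
by rewrite exchange_big; apply: eq_bigr => e _; rewrite mulr_sumr.
Qed.

Lemma expect0E : expect0 R I = (3 / 4 * m%:R : R)%:C.
Proof.
have ampJ : uniform_amp * ((uniform_amp)^*)%R = 2 ^- n.
  by rewrite -uniform_amp2 expr2; congr (_ * _); exact: conjc_real.
rewrite /expect0 uniform_stateE expectation_diag sum_cost.
  rewrite big1 ?mulr0 ?subr0// => e _.
  rewrite -mulr_suml -/uniform_amp ampJ [X in _ * X]mulrC ave_ZZ ?mulr0//.
  exact: end12_neq.
by rewrite -[RHS]card_bits_amp; apply: eq_bigr => y _; rewrite ampJ.
Qed.

Lemma qaoa1_stateE : qaoa1_state I gamma beta = colfn (mix beta phase_state).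
Proof. by rewrite /qaoa1_state expmx_mixer expmx_cost mul_opmx_colfn. Qed.

Lemma expect1E : expect1 I gamma beta = (3 / 4 * m%:R : R)%:C -
  4^-1 * \sum_e (parity I e)%:~R *
     \sum_(x : bits n) (-1) ^+ x (end1 I e) * (-1) ^+ x (end2 I e) *
       (mix beta phase_state x * ((mix beta phase_state x)^*)%R).
Proof.
rewrite /expect1 qaoa1_stateE expectation_diag sum_cost// mix_norm.
rewrite -[RHS]card_bits_amp; apply: eq_bigr => y _.
by rewrite phase_state_mulJ subrr mulr0 expi0 mulr1.
Qed.

End Expectation.

(** * The function g *)

Section GeneratingFunction.
Variable K : comNzRingType.
Implicit Types (a b t : K) (p q l : nat).

Lemma coef_linear_exp a b p i :
  ((a%:P + b *: 'X) ^+ p)`_i = 'C(p, i)%:R * (a ^+ (p - i) * b ^+ i).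
Proof.
rewrite exprDn.
under eq_bigr => j _.
  rewrite exprZn -polyC_exp -mul_polyC mulrA -polyCM -mulrnAl -polyCMn mul_polyC.
  over.
rewrite -(poly_def p.+1 (fun j => (a ^+ (p - j) * b ^+ j) *+ 'C(p, j))) coef_poly.
by case: ltnP => ip; rewrite ?mulr_natl// bin_small// mulr0n mul0r.
Qed.

(** The coefficient of t^l in (1 + t)^p (1 - t)^q, a value of a Krawtchouk polynomial. *)
Definition conv_coef p q l : K :=
  \sum_(0 <= k < l.+1) (-1) ^+ k * ('C(p, l - k) * 'C(q, k))%:R.

Lemma coef_linear_prod a b p q l : (l <= p + q)%N ->
  ((a%:P + b *: 'X) ^+ p * (a%:P + - b *: 'X) ^+ q)`_l =
  a ^+ (p + q - l) * b ^+ l * conv_coef p q l.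
Proof.
move=> lpq; rewrite coefMr /conv_coef big_mkord mulr_sumr.
apply: eq_bigr => -[k kl] _ /=; rewrite !coef_linear_exp natrM.
(* Out-of-range binomials vanish; in the remaining case no subtraction truncates and the exponents
   add up. *)
have [pk|kp] := ltnP p (l - k); first by rewrite bin_small// !(mul0r, mulr0).
have [qk|kq] := ltnP q k; first by rewrite (bin_small qk) !(mul0r, mulr0).
have -> : (p + q - l = (p - (l - k)) + (q - k))%N by lia.
have -> : b ^+ l = b ^+ (l - k) * b ^+ k by rewrite -exprD subnK// -ltnS.
by rewrite exprD (exprNn b); ring.
Qed.

Lemma linear_prod_sum a b t p q :
  (a + b * t) ^+ p * (a - b * t) ^+ q =
  \sum_(l < (p + q).+1) a ^+ (p + q - l) * b ^+ l * conv_coef p q l * t ^+ l.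
Proof.
pose Q := (a%:P + b *: 'X) ^+ p * (a%:P + - b *: 'X) ^+ q.
have sz c r : (size ((a%:P + c *: 'X) ^+ r) <= r.+1)%N.
  apply/leq_sizeP => j rj.
  by rewrite coef_linear_exp bin_small// mul0r.
have sQ : (size Q <= (p + q).+1)%N.
  apply: (leq_trans (size_polyMleq _ _)).
  have := leq_add (sz b p) (sz (- b) q).
  by move: (size _ + size _)%N => s; lia.
transitivity Q.[t]; first by rewrite /Q !hornerE mulNr.
rewrite (horner_coef_wide _ sQ); apply: eq_bigr => l _.
by rewrite coef_linear_prod// -ltnS.
Qed.
End GeneratingFunction.

(** The odd part is half the difference of the values at t = 1 and t = -1. Since a + b = 1, one of
    the two powers is 1 at each point. *)
Lemma gfunE (R : realType) (p q : nat) (gamma : R) :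
  gfun p q gamma = 2^-1 * ((cos (gamma / 2) ^+ 2 - sin (gamma / 2) ^+ 2) ^+ q
                         - (cos (gamma / 2) ^+ 2 - sin (gamma / 2) ^+ 2) ^+ p).
Proof.
set a := cos _ ^+ 2; set b := sin _ ^+ 2.
have ab : a + b = 1 by exact: cos2Dsin2.
have := linear_prod_sum a b 1 p q; have := linear_prod_sum a b (-1) p q.
rewrite !mulr1 !mulrN1 opprK ab !expr1n mul1r mulr1 => -> ->.
rewrite -sumrB mulr_sumr /gfun.
transitivity (\sum_(0 <= l < (p + q).+1 | odd l) a ^+ (p + q - l) * b ^+ l * conv_coef R p q l).
  (* The index 0 is even, so starting the sum there changes nothing. *)
  rewrite [RHS]big_ltn_cond//=; apply: eq_bigr => l _.
  by rewrite !exprM.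
rewrite big_mkcond big_mkord; apply: eq_bigr => l _.
by rewrite expr1n -signr_odd; case: odd; rewrite /=; field.
Qed.

(** * Counting triangles *)

Section Counting.
Variables (n m : nat) (I : instance n m).
Hypothesis simple : pair_at_most_once I.
Implicit Types (u v w : 'I_n) (e : 'I_m).

Lemma ends_inj : injective (ends I).
Proof.
move=> e e' ee'; apply/eqP; apply: contraT => ne.
have := simple (end12_neq I e).
rewrite leqNgt; suff -> : (1 < #|[set f | ends I f == [set end1 I e; end2 I e]]|)%N by [].
apply/card_gt1P; exists e, e'; split=> //; rewrite inE //.
by rewrite -ee'.
Qed.

Definition adj u w : bool := [exists e, ends I e == [set u; w]].

(** Integer-valued, to be compared directly with parities of triangles. *)
Definition pcoupling u w : int := \sum_(e | ends I e == [set u; w]) parity I e.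

Lemma couplingE (R : realType) u w : coupling R I u w = (pcoupling u w)%:~R.
Proof. by rewrite /coupling /pcoupling rmorph_sum. Qed.

Lemma adj_sym u w : adj u w = adj w u.
Proof. by rewrite /adj finset.setUC. Qed.

Lemma pcoupling_edge e u w : ends I e = [set u; w] -> pcoupling u w = parity I e.
Proof.
move=> ew; rewrite /pcoupling (bigD1 e) ?ew//= big1 ?addr0// => e' /andP[/eqP e'w].
by rewrite (ends_inj (etrans e'w (esym ew))) eqxx.
Qed.

Lemma pcoupling_nadj u w : ~~ adj u w -> pcoupling u w = 0.
Proof.
by move=> /existsPn nuw; rewrite /pcoupling big1// => e; rewrite (negbTE (nuw e)).
Qed.

Lemma adjP u w : reflect (exists e, ends I e = [set u; w]) (adj u w).
Proof. by apply: (iffP existsP) => -[e /eqP]; exists e; rewrite // ?ew; apply/eqP. Qed.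

Lemma nadj_xx u : ~~ adj u u.
Proof.
apply/existsPn => e; rewrite set2_eq ?end12_neq// orbb.
by apply/andP => -[/eqP au /eqP bu]; have := end12_neq I e; rewrite au bu eqxx.
Qed.

(** An edge at [u] is sent to its other endpoint, injectively because a pair carries at most one
    clause. *)
Lemma card_nbr u : #|[set w | adj u w]| = #|[set e | u \in ends I e]|.
Proof.
pose other e := if end1 I e == u then end2 I e else end1 I e.
have otherE e : u \in ends I e -> ends I e = [set u; other e].
  rewrite /other /ends !inE; case: (eqVneq (end1 I e) u) => [->//|].
  by move=> _ /eqP ->; rewrite finset.setUC.
rewrite -[RHS](card_in_imset (f := other)).
  apply: eq_card => w; rewrite inE; apply/adjP/imsetP => [[e ew]|[e]].
    have ue : u \in ends I e by rewrite ew finset.set21.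
    exists e; first by rewrite inE.
    have := otherE e ue; rewrite ew => /eqP.
    have uw : u != w.
      apply/eqP => uw; have /negP := nadj_xx u; apply.
      by rewrite {2}uw; apply/adjP; exists e.
    rewrite set2_eq// eqxx /= => /orP[/eqP//|/andP[/eqP uo /eqP wu]].
    by rewrite wu eqxx in uw.
  by rewrite inE => ue ->; exists e; exact: otherE.
move=> e e'; rewrite inE => ue; rewrite inE => ue' oo; apply: ends_inj.
by rewrite (otherE _ ue) (otherE _ ue') oo.
Qed.

(** As v is itself a neighbour of u, the predecessor in [dg] removes exactly v. *)
Lemma degE u v : adj u v -> #|[set w | [&& w != u, w != v & adj u w]]| = dg I u.
Proof.
move=> uv; rewrite /dg -card_nbr [in RHS](cardsD1 v) inE uv /=.
apply: eq_card => w; rewrite !inE.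
case: (eqVneq w u) => [->|//]; rewrite /= (negbTE (nadj_xx u)).
by rewrite andbF.
Qed.

(** * Triangles through a fixed edge *)

Section Triangles.
Variable e : 'I_m.
Local Notation u := (end1 I e).
Local Notation v := (end2 I e).

Definition third w := [&& w != u, w != v, adj u w & adj v w].

(** Taking all edges inside {u, v, w} avoids choosing the two further sides. *)
Definition triangle_on w : {set 'I_m} := [set e' | ends I e' \subset [set u; v; w]].

Lemma third_edges w : third w -> exists e1 e2,
  [/\ ends I e1 = [set u; w], ends I e2 = [set v; w],
      [&& e != e1, e != e2 & e1 != e2] & triangle_on w = [set e; e1; e2]].
Proof.
move=> /and4P[wu wv /adjP[e1 e1E] /adjP[e2 e2E]]; exists e1, e2.
have uv := end12_neq I e.
have neq (f g : 'I_m) x : x \in ends I f -> x \notin ends I g -> f != g.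
  by move=> xf; apply: contraNneq => <-.
split=> //; first apply/and3P; first split.
- by apply: (neq _ _ v); rewrite ?e1E !inE ?eqxx ?orbT// negb_or eq_sym uv eq_sym.
- by apply: (neq _ _ u); rewrite ?e2E !inE ?eqxx ?orbT// negb_or uv eq_sym.
- by apply: (neq _ _ u); rewrite ?e1E ?e2E !inE ?eqxx ?orbT// negb_or uv eq_sym.
apply/setP => f; rewrite !inE; apply/idP/idP; last first.
  move=> /orP[/orP[]|] /eqP ->; rewrite ?e1E ?e2E; apply/fintype.subsetP => x;
    by rewrite !inE => /orP[]/eqP ->; rewrite eqxx ?orbT.
move=> fs; have := end12_neq I f.
have : end1 I f \in [set u; v; w] by apply: (fintype.subsetP fs); exact: finset.set21.
have : end2 I f \in [set u; v; w] by apply: (fintype.subsetP fs); exact: finset.set22.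
(* An edge inside {u, v, w} is identified by its two endpoints, in either order: [fE] and [fE']
   treat the two orientations. *)
have fE (g : 'I_m) x y : ends I g = [set x; y] -> end1 I f = x -> end2 I f = y -> f == g.
  by move=> gE fx fy; apply/eqP/ends_inj; rewrite gE -fx -fy.
have fE' (g : 'I_m) x y : ends I g = [set x; y] -> end1 I f = y -> end2 I f = x -> f == g.
  by move=> gE fx fy; apply/eqP/ends_inj; rewrite gE -fx -fy /ends finset.setUC.
rewrite !inE => /orP[/orP[]|]/eqP f2 /orP[/orP[]|]/eqP f1; rewrite f1 f2 ?eqxx// => _.
- by rewrite (fE' e u v).
- by rewrite (fE' e1 u w)// orbT.
- by rewrite (fE e u v).
- by rewrite (fE' e2 v w)// !orbT.
- by rewrite (fE e1 u w)// orbT.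
- by rewrite (fE e2 v w)// !orbT.
Qed.

(** The side {u, w} lies inside {u, v, w'}, and w is neither u nor v. *)
Lemma triangle_on_inj : {in third &, injective triangle_on}.
Proof.
move=> w w' tw tw' ww'.
have [e1 [e2 [e1E _ _ Tw]]] := third_edges tw.
have : e1 \in triangle_on w' by rewrite -ww' Tw !inE eqxx orbT.
rewrite inE e1E => /fintype.subsetP/(_ w); rewrite !inE eqxx orbT => /(_ isT).
by case/and4P: tw => /negbTE -> /negbTE -> _ _ /= /eqP.
Qed.

Lemma triangle_parity_on w : third w ->
  triangle_parity I (triangle_on w) = parity I e * (pcoupling u w * pcoupling v w).
Proof.
move=> /third_edges[e1 [e2 [e1E e2E /and3P[n1 n2 n12] ->]]].
rewrite (pcoupling_edge e1E) (pcoupling_edge e2E) /triangle_parity.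
by rewrite -finset.setUA !big_setU1 ?big_set1 ?inE//= ?negb_or ?n1.
Qed.

Lemma triangle_on_triangle w : third w -> triangle I (triangle_on w).
Proof.
move=> tw; have [e1 [e2 [e1E e2E /and3P[n1 n2 n12] TE]]] := third_edges tw.
apply/andP; split.
  by rewrite TE -finset.setUA !cardsU1 cards1 !inE negb_or n1 n2 n12.
apply/existsP; exists u; apply/existsP; exists v; apply/existsP; exists w.
have uv := end12_neq I e.
case/and4P: tw => wu wv _ _.
rewrite /= !inE negb_or uv ![_ == w]eq_sym wu wv /= TE.
rewrite !imsetU !imset_set1 e1E e2E.
apply/eqP; rewrite -!finset.setUA; congr (_ :|: _).
exact: finset.setUC.
Qed.

Lemma triangle_third T : triangle I T -> e \in T ->
  exists2 w, third w & T = triangle_on w.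
Proof.
move=> /andP[_ /existsP[i /existsP[j /existsP[k /andP[ijk /eqP TE]]]]] eT.
pose D := [set i; j; k].
have DT a b : a \in D -> b \in D -> a != b -> exists2 f, f \in T & ends I f = [set a; b].
  move=> aD bD ab; suff : [set a; b] \in [set ends I f | f in T].
    by move=> /imsetP[f fT ->]; exists f.
  rewrite TE !inE; move: aD bD; rewrite !inE.
  by move=> /orP[/orP[]|]/eqP aE /orP[/orP[]|]/eqP bE; move: ab;
    rewrite aE bE ?eqxx ?orbT// => _; rewrite finset.setUC eqxx ?orbT.
have TD f : f \in T -> ends I f \subset D.
  move=> fT; have : ends I f \in [set ends I f | f in T] by exact: imset_f.
  rewrite TE !inE => /orP[/orP[]|]/eqP ->; apply/fintype.subsetP => x;
    by rewrite !inE => /orP[]/eqP ->; rewrite eqxx ?orbT.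
have eD := TD _ eT.
have uD : u \in D by apply: (fintype.subsetP eD); exact: finset.set21.
have vD : v \in D by apply: (fintype.subsetP eD); exact: finset.set22.
have uv := end12_neq I e.
have D3 : #|D| = 3%N.
  move: ijk; rewrite /= !inE negb_or => /andP[/andP[ij ik] /andP[jk _]].
  by rewrite /D -finset.setUA !cardsU1 cards1 !inE negb_or ij ik jk.
(* The third vertex is what is left of the three vertices once both ends of e are removed. *)
have /cards1P[w wE] : #|D :\ u :\ v| == 1%N.
  have := cardsD1 u D; rewrite D3 uD; have := cardsD1 v (D :\ u).
  by rewrite finset.in_setD1 vD eq_sym uv !add1n => -> [] <-.
have : w \in D :\ u :\ v by rewrite wE inE.
rewrite !inE => /and3P[wv wu wD'].
have wD : w \in D by rewrite !inE.
have DE : D = [set u; v; w].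
  have vDu : v \in D :\ u by rewrite finset.in_setD1 vD eq_sym uv.
  by rewrite -(finset.setD1K uD) -(finset.setD1K vDu) wE finset.setUA.
exists w.
  apply/and4P; split=> //; apply/adjP.
    by have [|f _ fE] := DT u w uD wD; [rewrite eq_sym|exists f].
  by have [|f _ fE] := DT v w vD wD; [rewrite eq_sym|exists f].
apply/setP => f; rewrite inE -DE; apply/idP/idP; first exact: TD.
(* Any edge inside the vertex set has the same ends as some edge of T, hence equals it. *)
move=> fD; have [|||g gT gE] := DT (end1 I f) (end2 I f).
- by apply: (fintype.subsetP fD); exact: finset.set21.
- by apply: (fintype.subsetP fD); exact: finset.set22.
- exact: end12_neq.
by rewrite -(ends_inj gE).
Qed.

Lemma num_trianglesE s : num_triangles I s e =
  #|[set w | third w & parity I e * (pcoupling u w * pcoupling v w) == s]|.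
Proof.
rewrite /num_triangles -[RHS](card_in_imset (f := triangle_on)); last first.
  move=> w w'; rewrite !inE => /andP[tw _] /andP[tw' _]; exact: triangle_on_inj.
apply: eq_card => T; rewrite inE; apply/and3P/imsetP => [[tT eT sT]|[w]].
  have [w tw TE] := triangle_third tT eT; exists w => //.
  by rewrite inE tw /= -triangle_parity_on// -TE.
rewrite inE => /andP[tw sw] ->; split; first exact: triangle_on_triangle.
  rewrite inE; apply/fintype.subsetP => x; rewrite !inE.
  by move=> /orP[]/eqP ->; rewrite eqxx ?orbT.
by rewrite triangle_parity_on.
Qed.
End Triangles.
End Counting.

Lemma card_setE (T : finType) (P : pred T) : #|[set x | P x]| = (\sum_x P x)%N.
Proof.
by rewrite -sum1_card big_mkcond; apply: eq_bigr => x _; rewrite inE; case: (P x).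
Qed.

Lemma prod_if_expr (K : comPzSemiRingType) (T : finType) (P : pred T) (a : K) :
  \prod_x (if P x then a else 1) = a ^+ #|[set x | P x]|.
Proof. by rewrite -big_mkcond -prodr_const; apply: eq_bigl => x; rewrite inE. Qed.

(** * Correlations across an edge when couplings are 0, 1 or -1 *)

Section Simple.
Variables (R : realType) (n m : nat) (I : instance n m).
Hypothesis simple : pair_at_most_once I.
Variable gamma : R.
Local Notation c := (cos (gamma / 2)).
Local Notation s := (sin (gamma / 2)).
Local Notation J := (coupling R I).

Lemma parity_cases e : parity I e = 1 \/ parity I e = -1.
Proof. by rewrite /parity; case: ifP => _; [right|left]. Qed.

Lemma pcoupling_cases u w :
  if adj I u w then pcoupling I u w = 1 \/ pcoupling I u w = -1
  else pcoupling I u w = 0.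
Proof.
case: ifPn => [/adjP[e ew]|]; last exact: pcoupling_nadj.
by rewrite (pcoupling_edge simple ew); exact: parity_cases.
Qed.

Lemma cos_coupling u w :
  cos (gamma / 2 * J u w) = if adj I u w then c else 1.
Proof.
rewrite couplingE; have := pcoupling_cases u w.
by case: ifP => _ => [[]|] ->; rewrite ?mulr1 ?rmorphN1 ?mulrN1 ?cosN ?mulr0 ?cos0.
Qed.

Lemma cos_double_half : cos (gamma / 2 + gamma / 2) = c ^+ 2 - s ^+ 2.
Proof. by rewrite cosD !expr2. Qed.

(** A vertex adjacent to one endpoint gives cos(gamma/2). For a common neighbour the angles either
    add to gamma or cancel, according to whether the product of couplings is [eps]. *)
Lemma cos_couplingD u v w (eps : int) : eps = 1 \/ eps = -1 ->
  cos (gamma / 2 * J u w + eps%:~R * (gamma / 2 * J v w)) =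
  (if adj I u w (+) adj I v w then c else 1) *
  (if [&& adj I u w, adj I v w & pcoupling I u w * pcoupling I v w == eps]
   then c ^+ 2 - s ^+ 2 else 1).
Proof.
move=> heps; rewrite -cos_double_half !couplingE.
have := pcoupling_cases u w; have := pcoupling_cases v w.
set g := gamma / 2.
by case: (adj I u w); case: (adj I v w) => /=; case: heps => ->;
  do 2?[case=> ->|move=> ->];
  rewrite /= ?rmorphN1 ?rmorph1 ?rmorph0 ?mulN1r ?mul1r ?mulr1 ?mulrN1 ?mulr0
    ?oppr0 ?opprK ?addr0 ?add0r ?subr0 ?cosN ?cos0 ?mul1r ?mulr1 ?subrr ?addNr ?cos0
    -?opprD ?cosN.
Qed.

Section Edge.
Variable e : 'I_m.
Local Notation u := (end1 I e).
Local Notation v := (end2 I e).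

Lemma coupling_end : J u v = (parity I e)%:~R.
Proof. by rewrite couplingE (pcoupling_edge simple (erefl (ends I e))). Qed.

Lemma prod_cos_end1 :
  \prod_(w | (w != u) && (w != v)) cos (gamma / 2 * J u w) = c ^+ dg I u.
Proof.
rewrite -(degE simple (v := v)); last by apply/adjP; exists e.
rewrite -prod_if_expr big_mkcond; apply: eq_bigr => w _.
by rewrite cos_coupling; case: (w != u); case: (w != v).
Qed.

Lemma prod_cos_end2 :
  \prod_(w | (w != u) && (w != v)) cos (gamma / 2 * J v w) = c ^+ dg I v.
Proof.
rewrite -(degE simple (v := u)); last first.
  by rewrite adj_sym; apply/adjP; exists e.
rewrite -prod_if_expr big_mkcond; apply: eq_bigr => w _.
by rewrite cos_coupling; case: (w != u); case: (w != v).
Qed.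

Definition nxor := #|[set w | [&& w != u, w != v & adj I u w (+) adj I v w]]|.

Definition nthird (eps : int) :=
  #|[set w | third I e w & pcoupling I u w * pcoupling I v w == eps]|.

Lemma prod_cosD (eps : int) : eps = 1 \/ eps = -1 ->
  \prod_(w | (w != u) && (w != v))
     cos (gamma / 2 * J u w + eps%:~R * (gamma / 2 * J v w)) =
  c ^+ nxor * (c ^+ 2 - s ^+ 2) ^+ nthird eps.
Proof.
move=> heps; rewrite -!prod_if_expr -big_split big_mkcond; apply: eq_bigr => w _.
rewrite cos_couplingD// /third.
by case: (w != u); case: (w != v) => //=; rewrite ?mulr1// andbA.
Qed.

(** The parity of e is its own inverse, so it moves to the other side of the triangle condition. *)
Lemma nthird_num (eps : int) : eps = 1 \/ eps = -1 ->
  num_triangles I eps e = nthird (parity I e * eps).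
Proof.
move=> heps; rewrite num_trianglesE//; apply: eq_card => w; rewrite !inE.
congr (_ && _); move: (pcoupling I u w * _) => t.
by case: (parity_cases e) => ->; rewrite ?mul1r ?mulN1r// eqr_oppLR.
Qed.

(** A common neighbour counts once in each degree and closes exactly one triangle. The exponent of
    the cosine thus counts the vertices adjacent to just one end of e. *)
Lemma degree_count :
  (nxor + 2 * (fplus I e + fminus I e) = dg I u + dg I v)%N.
Proof.
have -> : (fplus I e + fminus I e = nthird 1 + nthird (-1))%N.
  rewrite /fplus /fminus !nthird_num; [|by right|by left].
  by case: (parity_cases e) => ->; rewrite ?mul1r ?mulN1r ?opprK // addnC.
rewrite -(degE simple (v := v) (u := u)); last by apply/adjP; exists e.
rewrite -(degE simple (v := u) (u := v)); last first.
  by rewrite adj_sym; apply/adjP; exists e.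
rewrite /nxor /nthird !card_setE -!big_split big_distrr -!big_split /=.
apply: eq_bigr => w _; rewrite /third.
have := pcoupling_cases u w; have := pcoupling_cases v w.
case: (w != u); case: (w != v) => //; case: (adj I u w); case: (adj I v w) => //=.
by case=> [->|->] [->|->].
Qed.

Lemma edge_term (beta : R) :
  (parity I e)%:~R *
   (- (cos (2 * beta) * sin (2 * beta) * sin (gamma / 2 * J u v) *
      (\prod_(w | (w != u) && (w != v)) cos (gamma / 2 * J u w) +
       \prod_(w | (w != u) && (w != v)) cos (gamma / 2 * J v w))) -
   sin (2 * beta) ^+ 2 *
   (2^-1 *
    (\prod_(w | (w != u) && (w != v)) cos (gamma / 2 * J u w + gamma / 2 * J v w) -
     \prod_(w | (w != u) && (w != v)) cos (gamma / 2 * J u w - gamma / 2 * J v w)))) =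
  - (sin (4 * beta) * s / 2 * (c ^+ dg I u + c ^+ dg I v)) +
  sin (2 * beta) ^+ 2 *
    (c ^+ (dg I u + dg I v - 2 * fplus I e - 2 * fminus I e) *
     gfun (fplus I e) (fminus I e) gamma).
Proof.
have -> : (dg I u + dg I v - 2 * fplus I e - 2 * fminus I e = nxor)%N.
  by have := degree_count; lia.
have -> : sin (4 * beta) = 2 * (sin (2 * beta) * cos (2 * beta)).
  have -> : 4 * beta = 2 * beta + 2 * beta by ring.
  by rewrite sinD; ring.
rewrite gfunE prod_cos_end1 prod_cos_end2 coupling_end.
have := prod_cosD (or_introl (erefl : 1 = 1 :> int)).
under eq_bigr do rewrite mul1r.
move=> ->.
have := prod_cosD (or_intror (erefl : -1 = -1 :> int)).
under eq_bigr do rewrite rmorphN1 mulN1r.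
move=> ->.
rewrite /fplus /fminus !nthird_num; try by [left|right].
(* For parity -1 the two triangle counts trade places, which the outer sign compensates; the sign of
   the sine is absorbed likewise. *)
move: (c ^+ 2 - _ ^+ 2) => X.
by case: (parity_cases e) => ->; rewrite ?mul1r ?mulN1r ?opprK ?rmorph1
  ?rmorphN1 ?mulr1 ?mulrN1 ?sinN; field.
Qed.
End Edge.
End Simple.

(* The subtractions in the exponents never truncate, by [degree_count]. *)
Theorem mainTheorem7 (R : realType) (n m : nat) (I : instance n m)
    (bal : balanced I) (simple : pair_at_most_once I) (gamma beta : R) :
  expect0 R I = (3 / 4 * m%:R : R)%:C /\
  expect1 I gamma beta =
    expect0 R I +
    (sin (4 * beta) * sin (gamma / 2) / 8 *
       (\sum_(e < m) (cos (gamma / 2) ^+ dg I (end1 I e) +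
                      cos (gamma / 2) ^+ dg I (end2 I e)))
     - sin (2 * beta) ^+ 2 / 4 *
       (\sum_(e < m)
          cos (gamma / 2) ^+ (dg I (end1 I e) + dg I (end2 I e)
                              - 2 * fplus I e - 2 * fminus I e) *
          gfun (fplus I e) (fminus I e) gamma) : R)%:C.
Proof.
split; first exact: expect0E.
rewrite expect1E// expect0E//; congr (_ + _).
under eq_bigr => e _.
  rewrite (qaoa_ZZ bal gamma beta (end12_neq I e)) -(rmorph_int (real_complex R)) -rmorphM.
  rewrite edge_term//.
  over.
rewrite -rmorph_sum.
have -> : 4^-1 = (4^-1 : R)%:C by rewrite fmorphV rmorph_nat.
rewrite -rmorphM -rmorphN; congr (_%:C).
(* The weight -1/4 of the Ising energy turns the 1/2 of [edge_term] into 1/8 and reverses both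
   signs. *)
rewrite big_split /= sumrN -!mulr_sumr.
by field.
Qed.
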